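(* Let $R$ be a commutative ring and let $S$ be the antipode of the Hopf algebra $\mathtt{NCQSym}$ over $R$. Then $$-S(\mathrm{M}_{(13,2)})=\mathrm{M}_{(13,2)}-\mathrm{M}_{(123)}-\mathrm{M}_{(3,12)}-\mathrm{M}_{(12,3)},$$ $$-S(\mathrm{M}_{(2,13)})=\mathrm{M}_{(2,13)}-\mathrm{M}_{(123)}-\mathrm{M}_{(23,1)}-\mathrm{M}_{(1,23)},$$ $$-S(\mathrm{M}_{(23,1)})=\mathrm{M}_{(23,1)}-\mathrm{M}_{(123)}-\mathrm{M}_{(12,3)}-\mathrm{M}_{(3,12)},$$ $$-S(\mathrm{M}_{(3,12)})=\mathrm{M}_{(3,12)}-\mathrm{M}_{(123)}-\mathrm{M}_{(1,23)}-\mathrm{M}_{(23,1)}.$$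
   Context: Notation: set compositions are written without braces, e.g. $(13,2)$ is the set composition $(\{1,3\},\{2\})$ of $\{1,2,3\}$ and $(123)$ is $(\{1,2,3\})$. The Hopf algebra $\mathtt{NCQSym}$ (word quasi-symmetric functions). Put $\mathbb{N}_{n}=\{1,\ldots,n\}$. A set composition $\mathbf{A}=(A_{1},\ldots,A_{\ell})\vDash\mathbb{N}_{n}$ is an ordered collection of non-empty pairwise disjoint sets with union $\mathbb{N}_{n}$. In the ring of power series over $R$ in non-commuting variables $x_{1},x_{2},\ldots$, for $\mathbf{A}\vDash\mathbb{N}_{n}$ of length $\ell$ and $I=\{i_{1}<\cdots<i_{\ell}\}\subseteq\mathbb{N}$, let $x_{I}^{\mathbf{A}}=x_{\eta_{1}}x_{\eta_{2}}\cdots x_{\eta_{n}}$, where $\eta_{k}=i_{j}$ if $k\in A_{j}$, and set $\mathrm{M}_{\mathbf{A}}=\sum_{|I|=\ell}x_{I}^{\mathbf{A}}$ (with $\mathrm{M}_{\emptyset}=1$). $\mathtt{NCQSym}$ is the free $R$-module with basis $\{\mathrm{M}_{\mathbf{A}}\}$, $\mathbf{A}$ running over set compositions of $\mathbb{N}_{n}$ for all $n\geq0$, graded by $n$; it is closed under the product of power series. Its co-multiplication is $\Delta(\mathrm{M}_{\mathbf{A}})=\sum_{k=0}^{\ell}\mathrm{M}_{\operatorname{st}(A_{1},\ldots,A_{k})}\otimes\mathrm{M}_{\operatorname{st}(A_{k+1},\ldots,A_{\ell})}$, where $\operatorname{st}$ transports a set composition of a finite $X\subseteq\mathbb{N}$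 to one of $\mathbb{N}_{|X|}$ via the order-preserving bijection $X\to\mathbb{N}_{|X|}$; the co-unit is the projection onto degree $0$. This is a connected graded bi-algebra, hence a Hopf algebra, whose antipode is the two-sided convolution inverse of the identity. *)

(* Defs.v *)
From HB Require Import structures.
From mathcomp Require Import all_boot all_order all_algebra.
From mathcomp Require Import finmap.
From mathcomp.multinomials Require Import monalg.

Set Implicit Arguments.
Unset Strict Implicit.
Unset Printing Implicit Defensive.

Import GRing.Theory.
Local Open Scope fset_scope.

Definition fcover (bl : seq {fset nat}) : {fset nat} := \bigcup_(B <- bl) B.

Definition ordered_partition (bl : seq {fset nat}) : bool :=
  (fset0 \notin bl) && pairwise (fun B C => [disjoint B & C]) bl.

Definition is_setcomp (X : {fset nat}) (bl : seq {fset nat}) : bool :=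
  ordered_partition bl && (fcover bl == X).

Definition NN (n : nat) : {fset nat} := [fset k in iota 1 n].

Record setcomp := SetComp {
  sc_val : nat * seq {fset nat};
  _ : is_setcomp (NN sc_val.1) sc_val.2 }.

HB.instance Definition _ := [isSub for sc_val].
HB.instance Definition _ := [Choice of setcomp by <:].

Definition sc_deg (A : setcomp) : nat := (sc_val A).1.
Definition sc_blocks (A : setcomp) : seq {fset nat} := (sc_val A).2.
Coercion sc_blocks : setcomp >-> seq.

(* The order-preserving bijection from X onto NN #|` X|. *)
Definition rank (X : {fset nat}) (k : nat) : nat :=
  #|` [fset j in X | j <= k]|.

Definition st (bl : seq {fset nat}) : seq {fset nat} :=
  [seq [fset rank (fcover bl) k | k in B] | B : {fset nat} <- bl].

Lemma in_NN n k : (k \in NN n) = (0 < k <= n).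
Proof. by rewrite /NN in_fset mem_iota add1n ltnS. Qed.

Lemma in_cover bl k : (k \in fcover bl) = has (fun B : {fset nat} => k \in B) bl.
Proof.
rewrite /fcover; elim: bl => [|B bl IH]; first by rewrite big_nil in_fset0.
by rewrite big_cons in_fsetU IH.
Qed.

Lemma rank_lt (X : {fset nat}) j k :
  j \in X -> k \in X -> (rank X j < rank X k) = (j < k).
Proof.
have le a b : a <= b -> rank X a <= rank X b.
  move=> ab; apply: fsubset_leq_card; apply/fsubsetP => i; rewrite !inE /=.
  by case/andP => -> /leq_trans; apply.
move=> jX kX; case: (ltnP j k) => jk; last by rewrite ltnNge le.
apply: fproper_ltn_card; rewrite fproperEneq; apply/andP; split.
  apply/eqP => /fsetP /(_ k); rewrite !inE kX leqnn /= leqNgt jk //.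
apply/fsubsetP => i; rewrite !inE /=.
by case/andP => -> /leq_trans; apply; apply: ltnW.
Qed.

Lemma rank_inj (X : {fset nat}) : {in X &, injective (rank X)}.
Proof.
move=> j k jX kX e; apply/eqP.
by rewrite eqn_leq leqNgt -(rank_lt kX jX) e ltnn /= leqNgt -(rank_lt jX kX) e ltnn.
Qed.

Lemma rank_imfset (X : {fset nat}) : [fset rank X k | k in X] = NN #|` X|.
Proof.
apply/eqP; rewrite eqEfcard; apply/andP; split; last first.
  rewrite {1}/NN card_fseq undup_id ?iota_uniq // size_iota.
  by rewrite card_in_imfset //=; exact: rank_inj.
apply/fsubsetP => i /imfsetP [k /= kX ->]; rewrite in_NN; apply/andP; split.
  by rewrite cardfs_gt0; apply/fset0Pn; exists k; rewrite !inE kX leqnn.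
by apply: fsubset_leq_card; apply/fsubsetP => j; rewrite !inE => /andP [].
Qed.

Lemma in_cover_block bl (B : {fset nat}) : B \in bl -> B `<=` fcover bl.
Proof. by move=> Bb; apply/fsubsetP => k kB; rewrite in_cover; apply/hasP; exists B. Qed.

Lemma st_setcomp bl : ordered_partition bl -> is_setcomp (NN #|` fcover bl|) (st bl).
Proof.
move=> /andP [n0 dj]; apply/andP; split; [apply/andP; split |].
- apply/mapP => -[B Bb /fsetP e].
  have /fset0Pn [k kB] : B != fset0 by apply: contraNneq n0 => <-.
  by have := e (rank (fcover bl) k); rewrite in_fset0 in_imfset.
- rewrite pairwise_map; apply: (@sub_in_pairwise _ (mem bl) _ _ _ _ _ dj); last exact/allP.
  move=> B C Bb Cb /= /fdisjointP BC; apply/fdisjointP => i /imfsetP [k /= kB ->].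
  apply/imfsetP => -[j /= jC] /rank_inj e; move: (BC _ kB); rewrite e ?jC //.
  + exact: (fsubsetP (in_cover_block Bb)).
  + exact: (fsubsetP (in_cover_block Cb)).
- rewrite -rank_imfset; apply/eqP/fsetP => i; rewrite in_cover has_map.
  apply/hasP/imfsetP => [[B Bb /imfsetP [k /= kB ->]]|[k /= + ->]].
    by exists k => //; exact: (fsubsetP (in_cover_block Bb)).
  by rewrite in_cover => /hasP [B Bb kB]; exists B => //=; rewrite in_imfset.
Qed.

Definition st_sc bl (h : ordered_partition bl) : setcomp :=
  @SetComp (#|` fcover bl|, st bl) (st_setcomp h).

Lemma sc_ordered_partition (A : setcomp) : ordered_partition A.
Proof. by have /andP [] := valP A. Qed.

Lemma op_take k bl : ordered_partition bl -> ordered_partition (take k bl).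
Proof.
case/andP=> n0 dj; apply/andP; split; first by apply: contra n0; apply: mem_take.
exact: subseq_pairwise (take_subseq _ _) dj.
Qed.

Lemma op_drop k bl : ordered_partition bl -> ordered_partition (drop k bl).
Proof.
case/andP=> n0 dj; apply/andP; split; first by apply: contra n0; apply: mem_drop.
exact: subseq_pairwise (drop_subseq _ _) dj.
Qed.

Definition st_take k (A : setcomp) : setcomp :=
  st_sc (op_take k (sc_ordered_partition A)).
Definition st_drop k (A : setcomp) : setcomp :=
  st_sc (op_drop k (sc_ordered_partition A)).

Lemma sc_empty_proof : is_setcomp (NN 0) [::].
Proof.
rewrite /is_setcomp /ordered_partition /=; apply/eqP/fsetP => k.
by rewrite in_cover in_NN; case: k.
Qed.

Definition sc_empty : setcomp := @SetComp (0, [::]) sc_empty_proof.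

(* The boolean test evaluates, so that
   [sc [:: [:: 1; 3]; [:: 2]]] is the set composition (13,2). *)
Definition sc_wf (s : seq (seq nat)) : bool :=
  ([::] \notin s) && perm_eq (flatten s) (iota 1 (size (flatten s))).

Lemma sc_wf_setcomp s : sc_wf s ->
  is_setcomp (NN (size (flatten s))) [seq [fset k in b] | b : seq nat <- s].
Proof.
case/andP => n0 pe; have u : uniq (flatten s) by rewrite (perm_uniq pe) iota_uniq.
apply/andP; split; [apply/andP; split |].
- apply/mapP => -[[|x b] bs /fsetP e]; first by rewrite bs in n0.
  by have := e x; rewrite !inE eqxx.
- elim: s {n0 pe} u => //= b s IH; rewrite cat_uniq => /and3P [_ /hasPn nb /IH ->].
  rewrite andbT; apply/allP => _ /mapP [c cs ->]; apply/fdisjointP => x.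
  rewrite !inE => xb; apply: contraL xb => xc; apply: nb.
  by apply/flattenP; exists c.
- apply/eqP/fsetP => k; rewrite in_cover in_fset -(perm_mem pe) has_map.
  apply/hasP/flattenP => -[b bs kb]; exists b => //; by move: kb; rewrite /= in_fset.
Qed.

Definition setcomp_of (s : seq (seq nat)) (h : sc_wf s) : setcomp :=
  @SetComp (size (flatten s), [seq [fset k in b] | b : seq nat <- s])
    (sc_wf_setcomp h).

(* A power series in the non-commuting variables x_1, x_2, ... is given by its
   coefficients; the letter i of a word stands for x_(i+1). *)

Definition ncseries (R : Type) := seq nat -> R.

Definition ps_one {R : pzRingType} : ncseries R := fun w => (w == [::])%:R%R.

Definition ps_mul {R : pzRingType} (f g : ncseries R) : ncseries R :=
  fun w => (\sum_(k < (size w).+1) f (take k w) * g (drop k w))%R.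

(* [xword I A] is x_I^A, for I the list i_1 < ... < i_l. *)
Definition xword (I : seq nat) (A : setcomp) : seq nat :=
  [seq nth 0 I (find (fun B : {fset nat} => k \in B) A) | k <- iota 1 (sc_deg A)].

(* The coefficient of w in the sum of all x_I^A with #|I| = l.  The sum is
   finite because all letters of x_I^A are in I, and all elements of I are
   letters of x_I^A, so only sets I of letters of w contribute. *)
Definition Mseries (R : pzRingType) (A : setcomp) : ncseries R := fun w =>
  (\sum_(I <- fpowerset [fset i in w] | #|` I| == size A)
     (w == xword (sort leq I) A)%:R)%R.

(* The unique A of length l such that w = x_I^A with #|I| = l. *)
Definition comp_blocks (w : seq nat) : seq {fset nat} :=
  [seq [fset k in iota 1 (size w) | nth 0 w k.-1 == x]%fset
     | x <- sort leq (undup w)].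

Lemma comp_setcomp w : is_setcomp (NN (size w)) (comp_blocks w).
Proof.
apply/andP; split; [apply/andP; split |].
- apply/mapP => -[x]; rewrite mem_sort mem_undup => xw /fsetP /(_ (index x w).+1).
  by rewrite !inE mem_iota /= add1n ltnS index_mem xw nth_index ?eqxx.
- rewrite pairwise_map; have : uniq (sort leq (undup w)) by rewrite sort_uniq undup_uniq.
  elim: (sort _ _) => //= x s IH /andP [xs /IH ->]; rewrite andbT.
  apply/allP => y ys; apply/fdisjointP => k; rewrite !inE => /andP [_ /eqP ->].
  by rewrite negb_and orbC; apply/orP; left; apply: contraNneq xs => ->.
- apply/eqP/fsetP => k; rewrite in_cover in_NN has_map.
  apply/hasP/idP => [[x _]|kw]; first by rewrite /= !inE mem_iota add1n ltnS => /andP [].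
  have k1 : k.-1 < size w by move: kw; case: k.
  exists (nth 0 w k.-1); first by rewrite mem_sort mem_undup mem_nth.
  by rewrite /= !inE mem_iota add1n ltnS kw eqxx.
Qed.

Definition sc_of_word (w : seq nat) : setcomp :=
  @SetComp (size w, comp_blocks w) (comp_setcomp w).

(* The word of A for I = {1, ..., l}. *)
Definition canon (A : setcomp) : seq nat := xword (iota 0 (size A)) A.

Lemma setcomp_eq (A B : setcomp) :
  sc_deg A = sc_deg B -> (A : seq _) = B -> A = B.
Proof.
rewrite /sc_deg /sc_blocks => dAB bAB; apply/val_inj => /=.
by rewrite [LHS]surjective_pairing [RHS]surjective_pairing dAB bAB.
Qed.

Lemma size_xword I A : size (xword I A) = sc_deg A.
Proof. by rewrite size_map size_iota. Qed.

Lemma sc_cover (A : setcomp) : fcover A = NN (sc_deg A).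
Proof. by have /andP [_ /eqP] := valP A. Qed.

Lemma sc_find_lt (A : setcomp) k : k \in iota 1 (sc_deg A) ->
  find (fun B : {fset nat} => k \in B) A < size A.
Proof. by rewrite mem_iota add1n ltnS -has_find -in_NN -sc_cover in_cover. Qed.

Lemma sc_findP (A : setcomp) j k : j < size A ->
  (k \in nth fset0 A j) =
  (k \in iota 1 (sc_deg A)) && (find (fun B : {fset nat} => k \in B) A == j).
Proof.
move=> jA; have kE : (k \in iota 1 (sc_deg A)) = (k \in fcover A).
  by rewrite sc_cover in_NN mem_iota add1n ltnS.
apply/idP/andP => [kj|[+ /eqP <-]]; last first.
  by rewrite kE in_cover => /(nth_find fset0).
have hk : has (fun B : {fset nat} => k \in B) A.
  by apply/hasP; exists (nth fset0 A j) => //; rewrite mem_nth.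
rewrite kE in_cover hk; split=> //; move: (hk); rewrite has_find => fA.
have kf := nth_find fset0 hk.
have /andP [_ /(pairwiseP fset0) dj] := sc_ordered_partition A.
case: ltngtP => // fj.
  by have /fdisjointP /(_ _ kf) := dj _ _ fA jA fj; rewrite kj.
by have /fdisjointP /(_ _ kj) := dj _ _ jA fA fj; rewrite kf.
Qed.

Lemma xwordE I (A : setcomp) : size I = size A ->
  xword I A = map (nth 0 I) (canon A).
Proof.
move=> sI; rewrite /canon /xword -map_comp; apply/eq_in_map => k kA /=.
by rewrite nth_iota // sc_find_lt.
Qed.

Lemma canon_lt (A : setcomp) x : x \in canon A -> x < size A.
Proof. by case/mapP => k kA ->; rewrite nth_iota ?sc_find_lt. Qed.

Lemma letters_canon (A : setcomp) : sort leq (undup (canon A)) = iota 0 (size A).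
Proof.
apply: (@sorted_eq _ leq) => //; try exact: leq_trans; try exact: anti_leq.
- exact/sort_sorted/leq_total.
- exact: iota_sorted.
rewrite perm_sort; apply: uniq_perm; rewrite ?undup_uniq ?iota_uniq // => x.
rewrite mem_undup mem_iota add0n leq0n /=; apply/idP/idP; first exact: canon_lt.
move=> xA; have /andP [n0 _] := sc_ordered_partition A.
have /fset0Pn [k] : nth fset0 A x != fset0.
  by apply: contraNneq n0 => <-; rewrite mem_nth.
rewrite sc_findP // => /andP [kA /eqP e].
by apply/mapP; exists k => //; rewrite e nth_iota.
Qed.

Lemma comp_canon (A : setcomp) : sc_of_word (canon A) = A.
Proof.
apply: setcomp_eq; first by rewrite /sc_deg /= size_xword.
rewrite {1}/sc_blocks /= /comp_blocks letters_canon size_xword.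
apply: (@eq_from_nth _ fset0); rewrite size_map size_iota // => j jA.
rewrite (nth_map 0) ?size_iota // nth_iota // add0n; apply/fsetP => k.
rewrite sc_findP // !inE /=; case kA: (k \in iota _ _) => //=.
move: (kA); rewrite mem_iota add1n ltnS => /andP [k0 k1].
have k2 : k.-1 < sc_deg A by case: k k0 k1 {kA}.
have kE : nth 0 (iota 1 (sc_deg A)) k.-1 = k by rewrite nth_iota // add1n prednK.
rewrite /canon /xword (nth_map 0) ?size_iota // kE.
by rewrite nth_iota // sc_find_lt.
Qed.

Lemma comp_map (f : nat -> nat) w :
  {in w &, {mono f : x y / x < y}} -> sc_of_word (map f w) = sc_of_word w.
Proof.
move=> fm; have fi : {in w &, injective f}.
  move=> x y xw yw e; apply/eqP.
  by rewrite eqn_leq leqNgt -(fm _ _ yw xw) e ltnn /= leqNgt -(fm _ _ xw yw) e ltnn.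
have sE : sort leq (undup (map f w)) = map f (sort leq (undup w)).
  apply: (@sorted_eq _ leq) => //; try exact: leq_trans; try exact: anti_leq.
  - exact/sort_sorted/leq_total.
  - rewrite sorted_map; apply: (@sub_in_sorted _ (mem w) leq).
    + by move=> x y xw yw; rewrite /relpre /= leqNgt => xy; rewrite leqNgt fm.
    + by apply/allP => x; rewrite mem_sort mem_undup.
    + exact/sort_sorted/leq_total.
  rewrite perm_sort; apply: uniq_perm; rewrite ?undup_uniq //.
    rewrite map_inj_in_uniq ?sort_uniq ?undup_uniq // => x y.
    by rewrite !mem_sort !mem_undup; apply: fi.
  move=> x; rewrite mem_undup; apply/mapP/mapP => -[y yw ->]; exists y => //.
    by rewrite mem_sort mem_undup.
  by move: yw; rewrite mem_sort mem_undup.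
apply: setcomp_eq; first by rewrite /sc_deg /= size_map.
rewrite /sc_blocks /= /comp_blocks sE size_map -map_comp.
apply/eq_in_map => x; rewrite mem_sort mem_undup => xw /=; apply/fsetP => k.
rewrite !inE; case kw: (k \in iota _ _) => //=.
have kw1 : k.-1 < size w by move: kw; rewrite mem_iota add1n; case: k.
by rewrite (nth_map 0) // (inj_in_eq fi) // mem_nth.
Qed.

Lemma nth_mono I n : sorted ltn I -> n <= size I ->
  {in gtn n &, {mono nth 0 I : x y / x < y}}.
Proof.
move=> sI nI x y; rewrite !inE => xn yn.
have lt a b : b < n -> a < b -> nth 0 I a < nth 0 I b.
  move=> bn ab; apply: (sorted_ltn_nth ltn_trans) => //; rewrite inE.
    exact: ltn_trans ab (leq_trans bn nI).
  exact: leq_trans bn nI.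
case: (ltngtP x y) => [xy|yx|->]; last by rewrite ltnn.
  exact: lt.
by apply/negbTE; rewrite -leqNgt ltnW // lt.
Qed.

Lemma comp_xword I (A : setcomp) :
  sorted ltn I -> size I = size A -> sc_of_word (xword I A) = A.
Proof.
move=> sI nI; rewrite xwordE // comp_map ?comp_canon //.
by move=> x y /canon_lt xA /canon_lt yA; apply: (nth_mono sI (leqnn _)); rewrite inE nI.
Qed.

Lemma ltn_sorted_letters (w : seq nat) : sorted ltn (sort leq (undup w)).
Proof.
by rewrite ltn_sorted_uniq_leq sort_uniq undup_uniq; exact/sort_sorted/leq_total.
Qed.

Lemma size_comp w : size (sc_of_word w) = size (sort leq (undup w)).
Proof. by rewrite size_map. Qed.

Lemma xword_comp w : xword (sort leq (undup w)) (sc_of_word w) = w.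
Proof.
apply: (@eq_from_nth _ 0) => [|i]; rewrite size_xword // /sc_deg /= => iw.
rewrite /xword /sc_deg /= (nth_map 0) ?size_iota // nth_iota // add1n.
have iA : i.+1 \in iota 1 (sc_deg (sc_of_word w)) by rewrite mem_iota add1n.
have fl := sc_find_lt iA; set j := find _ _ in fl *.
have : i.+1 \in nth fset0 (sc_of_word w) j by rewrite sc_findP // iA /= eqxx.
rewrite size_comp in fl.
by rewrite (nth_map 0) // !inE /= => /andP [_ /eqP].
Qed.

Lemma letters_xword I (A : setcomp) : sorted ltn I -> size I = size A ->
  sort leq (undup (xword I A)) = I.
Proof.
move=> sI nI; have := xword_comp (xword I A); rewrite comp_xword //.
set J := sort _ _ => e.
have nJ : size J = size A by rewrite -(comp_xword sI nI) size_comp.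
apply: (@eq_from_nth _ 0); rewrite ?nI ?nJ // => j jA.
have: j \in canon A.
  by rewrite -mem_undup -(mem_sort leq) letters_canon mem_iota.
have /eq_in_map : map (nth 0 J) (canon A) = map (nth 0 I) (canon A).
  by rewrite -!xwordE.
exact.
Qed.

Lemma sort_fset (I : {fset nat}) : sorted ltn (sort leq I).
Proof.
by rewrite ltn_sorted_uniq_leq sort_uniq fset_uniq; exact/sort_sorted/leq_total.
Qed.

Lemma MseriesE (R : pzRingType) A w : Mseries R A w = (sc_of_word w == A)%:R%R.
Proof.
have sL : sort leq [fset i in w] = sort leq (undup w).
  apply/perm_sortP; [exact: leq_total|exact: leq_trans|exact: anti_leq|].
  by apply: uniq_perm; rewrite ?fset_uniq ?undup_uniq // => x; rewrite inE mem_undup.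
rewrite /Mseries; case: eqP => [<-|wA]; last first.
  rewrite big1_seq // => I /andP [/eqP cI _]; case: eqP => // e; case: wA.
  by rewrite e comp_xword ?sort_fset ?size_sort.
have wI : [fset i in w] \in [seq I : {fset nat} <- fpowerset [fset i in w] |
                               #|` I| == size (sc_of_word w)].
  by rewrite mem_filter fpowersetE fsubset_refl andbT size_comp -sL size_sort.
rewrite -big_filter (bigD1_seq _ wI) ?filter_uniq ?fset_uniq //=.
rewrite sL xword_comp eqxx big_seq_cond big1 ?GRing.addr0 //= => I.
rewrite mem_filter => /andP [/andP [/eqP cI _] neI]; case: eqP => // e.
case/eqP: neI; apply/fsetP => x; rewrite inE.
have e2 : sort leq (undup w) = sort leq I.
  by rewrite [in LHS]e letters_xword ?sort_fset ?size_sort.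
by rewrite -[RHS]mem_undup -[RHS](mem_sort leq) e2 mem_sort.
Qed.

Lemma comp_takedrop w w' k : sc_of_word w = sc_of_word w' ->
  sc_of_word (take k w) = sc_of_word (take k w') /\ sc_of_word (drop k w) = sc_of_word (drop k w').
Proof.
suff H v : sc_of_word (take k v) = sc_of_word (take k (canon (sc_of_word v))) /\
           sc_of_word (drop k v) = sc_of_word (drop k (canon (sc_of_word v))).
  by have [-> ->] := H w; have [-> ->] := H w' => ->.
set A := sc_of_word v; set I := sort leq (undup v).
have vE : v = map (nth 0 I) (canon A).
  by rewrite -xwordE ?xword_comp // -size_comp.
have mI : {in canon A &, {mono nth 0 I : x y / x < y}}.
  move=> x y /canon_lt xA /canon_lt yA.
  by apply: (nth_mono (ltn_sorted_letters v) (leqnn _)); rewrite inE -size_comp.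
rewrite [in LHS]vE [in X in _ /\ X = _]vE -map_take -map_drop; split; apply: comp_map.
  by move=> x y /mem_take xA /mem_take yA; apply: mI.
by move=> x y /mem_drop xA /mem_drop yA; apply: mI.
Qed.

Local Open Scope ring_scope.

Definition NCQSym (R : comPzRingType) : Type := {malg R[setcomp]}.

Section NCQSymModule.
Variable R : comPzRingType.

HB.instance Definition _ := GRing.Zmodule.copy (NCQSym R) {malg R[setcomp]}.

(* monalg equips {malg R[K]} with scaling only for non-trivial R. *)
Definition nc_scale (c : R) (p : NCQSym R) : NCQSym R :=
  [malg A in msupp p => c * p@_A].

Lemma nc_scaleE c p A : (nc_scale c p)@_A = c * p@_A.
Proof. by rewrite mcoeffE; case: msuppP => //; rewrite mulr0. Qed.

Lemma nc_scaleA c1 c2 p : nc_scale c1 (nc_scale c2 p) = nc_scale (c1 * c2) p.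
Proof. by apply/malgP => A; rewrite !nc_scaleE mulrA. Qed.
Lemma nc_scale1 : left_id 1 nc_scale.
Proof. by move=> p; apply/malgP => A; rewrite nc_scaleE mul1r. Qed.
Lemma nc_scaleDr : right_distributive nc_scale +%R.
Proof. by move=> c p q; apply/malgP => A; rewrite mcoeffD !nc_scaleE mcoeffD mulrDr. Qed.
Lemma nc_scaleDl p : {morph nc_scale^~ p : c1 c2 / c1 + c2}.
Proof. by move=> c d; apply/malgP => A; rewrite mcoeffD !nc_scaleE mulrDl. Qed.

HB.instance Definition _ := GRing.Zmodule_isLmodule.Build R (NCQSym R)
  nc_scaleA nc_scale1 nc_scaleDr nc_scaleDl.

Lemma nc_mcoeffZ c (p : NCQSym R) A : (c *: p)@_A = c * p@_A.
Proof. exact: nc_scaleE. Qed.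

End NCQSymModule.

Definition M (R : comPzRingType) (A : setcomp) : NCQSym R := << A >>.

Section NCQSymProduct.
Variable R : comPzRingType.
Implicit Types (p q r : NCQSym R) (A B C : setcomp) (w : seq nat).

Definition to_series p : ncseries R :=
  fun w => \sum_(A <- msupp p) p@_A * Mseries R A w.

Definition setcomps (n : nat) : {fset setcomp} :=
  [fset sc_of_word (map val (w : seq 'I_n)) | w : n.-tuple 'I_n in predT].

(* NCQSym is closed under the product of power series, and this is the
   restriction of that product: nc_mul p q is the element of NCQSym whose power
   series is the product of the power series of p and q ([to_seriesM] and
   [to_series_inj]).  Its coefficient at M_C is read off at the monomial
   [canon C], which occurs in M_C and in no other M_D; the finite set over
   which C ranges contains all set compositions of the possible degrees. *)
Definition nc_mul p q : NCQSym R :=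
  [malg C in \bigcup_(A <- msupp p) \bigcup_(B <- msupp q)
               setcomps (sc_deg A + sc_deg B)
   => ps_mul (to_series p) (to_series q) (canon C)].

Definition nc_one : NCQSym R := M R sc_empty.

Lemma in_setcomps n C : (C \in setcomps n) = (sc_deg C == n).
Proof.
apply/imfsetP/eqP => [[w _ ->]|dC]; first by rewrite /sc_deg /= size_map size_tuple.
have Cn : all (gtn n) (canon C).
  apply/allP => x /canon_lt xC; apply: (leq_trans xC).
  rewrite -{1}(comp_canon C) size_comp size_sort -dC.
  by apply: (leq_trans (size_undup _)); rewrite size_xword.
have mE : map val (pmap insub (canon C) : seq 'I_n) = canon C.
  rewrite (pmap_filter (insubK _)); apply/all_filterP.
  by apply: sub_all Cn => x xn; rewrite /= insubT.
have sz : size (pmap insub (canon C) : seq 'I_n) == n.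
  by rewrite -(size_map val) mE size_xword dC.
by exists (Tuple sz) => //=; rewrite mE comp_canon.
Qed.

Lemma to_seriesE p w : to_series p w = p@_(sc_of_word w).
Proof.
rewrite /to_series; case: (msuppP p (sc_of_word w)) => [h|h].
  rewrite (bigD1_seq (sc_of_word w)) ?fset_uniq //= MseriesE eqxx mulr1.
  rewrite big1 ?addr0 // => A neA.
  by rewrite MseriesE eq_sym (negbTE neA) mulr0.
rewrite big1_seq // => A /= Ap; rewrite MseriesE; case: eqP => [e|]; last by rewrite mulr0.
by rewrite e Ap in h.
Qed.

Lemma to_series_inj p q : to_series p =1 to_series q -> p = q.
Proof.
by move=> e; apply/malgP => A; rewrite -[A]comp_canon -!to_seriesE.
Qed.

Lemma to_series_M A w : to_series (M R A) w = Mseries R A w.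
Proof. by rewrite to_seriesE mcoeffU MseriesE eq_sym. Qed.

Lemma to_seriesD p q w : to_series (p + q) w = to_series p w + to_series q w.
Proof. by rewrite !to_seriesE mcoeffD. Qed.

Lemma to_seriesZ c p w : to_series (c *: p) w = c * to_series p w.
Proof. by rewrite !to_seriesE nc_mcoeffZ. Qed.

Lemma to_series1 w : to_series nc_one w = ps_one w.
Proof.
rewrite to_series_M MseriesE /ps_one; congr (nat_of_bool _)%:R.
apply/eqP/eqP => [/(congr1 sc_deg)|->]; first by case: w.
exact: setcomp_eq.
Qed.

Lemma ps_mul_comp p q w w' : sc_of_word w = sc_of_word w' ->
  ps_mul (to_series p) (to_series q) w = ps_mul (to_series p) (to_series q) w'.
Proof.
move=> e; have s : size w = size w' by have := congr1 sc_deg e.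
rewrite /ps_mul s; apply: eq_bigr => k _; rewrite !to_seriesE.
by have [-> ->] := comp_takedrop k e.
Qed.

Lemma to_seriesM p q w :
  to_series (nc_mul p q) w = ps_mul (to_series p) (to_series q) w.
Proof.
rewrite to_seriesE mcoeffE -(@ps_mul_comp p q w (canon (sc_of_word w))) ?comp_canon //.
case: ifPn => // h; rewrite /ps_mul big1 // => k _; rewrite !to_seriesE.
case: (msuppP p) => hp; last by rewrite mul0r.
case: (msuppP q) => hq; last by rewrite mulr0.
case/negP: h; apply/bigfcupP; exists (sc_of_word (take k w)); rewrite ?hp //.
apply/bigfcupP; exists (sc_of_word (drop k w)); rewrite ?hq //.
by rewrite in_setcomps /sc_deg /= -size_cat cat_take_drop.
Qed.

Lemma ps_mul_ext (f f' g g' : ncseries R) : f =1 f' -> g =1 g' ->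
  ps_mul f g =1 ps_mul f' g'.
Proof. by move=> ef eg w; apply: eq_bigr => k _; rewrite ef eg. Qed.

Lemma ps_mul_cons (f g : ncseries R) x w :
  ps_mul f g (x :: w) = f [::] * g (x :: w) + ps_mul (fun v => f (x :: v)) g w.
Proof. by rewrite /ps_mul big_ord_recl. Qed.

Lemma ps_mulDl (f1 f2 g : ncseries R) w :
  ps_mul (fun v => f1 v + f2 v) g w = ps_mul f1 g w + ps_mul f2 g w.
Proof. by rewrite /ps_mul -big_split; apply: eq_bigr => k _; rewrite mulrDl. Qed.

Lemma ps_mulDr (f g1 g2 : ncseries R) w :
  ps_mul f (fun v => g1 v + g2 v) w = ps_mul f g1 w + ps_mul f g2 w.
Proof. by rewrite /ps_mul -big_split; apply: eq_bigr => k _; rewrite mulrDr. Qed.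

Lemma ps_mulZl c (f g : ncseries R) w :
  ps_mul (fun v => c * f v) g w = c * ps_mul f g w.
Proof. by rewrite /ps_mul mulr_sumr; apply: eq_bigr => k _; rewrite mulrA. Qed.

Lemma ps_mulZr c (f g : ncseries R) w :
  ps_mul f (fun v => c * g v) w = c * ps_mul f g w.
Proof. by rewrite /ps_mul mulr_sumr; apply: eq_bigr => k _; rewrite mulrCA. Qed.

Lemma ps_mulA (f g h : ncseries R) :
  ps_mul f (ps_mul g h) =1 ps_mul (ps_mul f g) h.
Proof.
move=> w; elim: w f g h => [|x w IH] f g h.
  by rewrite /ps_mul /= !big_ord1 /= ?big_ord1 /= mulrA.
rewrite !ps_mul_cons.
have e : (fun v => ps_mul f g (x :: v)) =1
         (fun v => f [::] * g (x :: v) + ps_mul (fun u => f (x :: u)) g v).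
  by move=> v; rewrite ps_mul_cons.
rewrite (ps_mul_ext e (frefl h)).
rewrite ps_mulDl ps_mulZl mulrDr addrA IH mulrA.
by rewrite [ps_mul f g [::]]/ps_mul big_ord1.
Qed.

Lemma ps_mul1l (f : ncseries R) : ps_mul ps_one f =1 f.
Proof.
move=> w; rewrite /ps_mul big_ord_recl take0 drop0 /ps_one eqxx mul1r.
rewrite big1 ?addr0 // => k _; case: w k => [|x w] k; first by case: k.
by rewrite /= mul0r.
Qed.

Lemma ps_mul1r (f : ncseries R) : ps_mul f ps_one =1 f.
Proof.
move=> w; rewrite /ps_mul big_ord_recr /= take_size drop_size /ps_one eqxx mulr1.
rewrite big1 ?add0r // => k _; rewrite -size_eq0 size_drop subn_eq0 leqNgt.
by rewrite ltn_ord mulr0.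
Qed.

Lemma nc_mulA : associative nc_mul.
Proof.
move=> p q r; apply: to_series_inj => w; rewrite !to_seriesM.
rewrite (ps_mul_ext (frefl _) (to_seriesM q r)).
by rewrite (ps_mul_ext (to_seriesM p q) (frefl _)) ps_mulA.
Qed.

Lemma nc_mul1l : left_id nc_one nc_mul.
Proof.
move=> p; apply: to_series_inj => w.
by rewrite to_seriesM (ps_mul_ext to_series1 (frefl _)) ps_mul1l.
Qed.

Lemma nc_mul1r : right_id nc_one nc_mul.
Proof.
move=> p; apply: to_series_inj => w.
by rewrite to_seriesM (ps_mul_ext (frefl _) to_series1) ps_mul1r.
Qed.

Lemma nc_mulDl : left_distributive nc_mul +%R.
Proof.
move=> p q r; apply: to_series_inj => w; rewrite to_seriesD !to_seriesM.
by rewrite (ps_mul_ext (to_seriesD p q) (frefl _)) ps_mulDl.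
Qed.

Lemma nc_mulDr : right_distributive nc_mul +%R.
Proof.
move=> p q r; apply: to_series_inj => w; rewrite to_seriesD !to_seriesM.
by rewrite (ps_mul_ext (frefl _) (to_seriesD q r)) ps_mulDr.
Qed.

HB.instance Definition _ := GRing.Zmodule_isPzRing.Build (NCQSym R)
  nc_mulA nc_mul1l nc_mul1r nc_mulDl nc_mulDr.

Lemma nc_scaleAl (c : R) (p q : NCQSym R) : c *: (p * q) = c *: p * q.
Proof.
apply: to_series_inj => w; rewrite to_seriesZ !to_seriesM.
by rewrite (ps_mul_ext (to_seriesZ c p) (frefl _)) ps_mulZl.
Qed.

Lemma nc_scaleAr (c : R) (p q : NCQSym R) : c *: (p * q) = p * (c *: q).
Proof.
apply: to_series_inj => w; rewrite to_seriesZ !to_seriesM.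
by rewrite (ps_mul_ext (frefl _) (to_seriesZ c q)) ps_mulZr.
Qed.

End NCQSymProduct.

Section NCQSymHopf.
Variable R : comPzRingType.
Implicit Types (p : NCQSym R) (f g : NCQSym R -> NCQSym R).

(* The tensor square of NCQSym is the free module on the M_A (x) M_B, here
   << (A, B) >>. *)
Definition Delta p : {malg R[(setcomp * setcomp)%type]} :=
  \sum_(A <- msupp p)
    \sum_(k < (size A).+1) << p@_A *g (st_take k A, st_drop k A) >>.

(* The only basis element of degree 0 is M_sc_empty = 1. *)
Definition counit p : R := p@_sc_empty.

(* mul o (f (x) g) o Delta, for linear f and g. *)
Definition convolution f g p : NCQSym R :=
  \sum_(AB <- msupp (Delta p))
    (Delta p)@_AB *: (f (M R AB.1) * g (M R AB.2)).

Lemma Delta_M A :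
  Delta (M R A) = \sum_(k < (size A).+1) << (st_take k A, st_drop k A) >>.
Proof.
rewrite /Delta /M msuppU; case: eqP => [R0|_]; last first.
  by rewrite big_seq_fset1 mcoeffUU.
have t0 (x : R) : x = 0 by rewrite -[x]mul1r R0 mul0r.
by rewrite big_seq_fset0; apply/malgP => AB; rewrite mcoeff0 [RHS]t0.
Qed.

Lemma convolution_M (f g : {linear NCQSym R -> NCQSym R}) A :
  convolution f g (M R A) =
  \sum_(k < (size A).+1) f (M R (st_take k A)) * g (M R (st_drop k A)).
Proof.
have -> : convolution f g (M R A) =
    \sum_(AB <- [fset (st_take k A, st_drop k A) | k : 'I_(size A).+1 in predT])
       (Delta (M R A))@_AB *: (f (M R AB.1) * g (M R AB.2)).
  apply: big_fset_incl; last first.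
    by move=> AB _ /mcoeff_outdom ->; rewrite scale0r.
  apply/fsubsetP => AB; apply: contraTT => h; rewrite -mcoeff_eq0 Delta_M.
  rewrite raddf_sum big1 //= => k _; rewrite mcoeffU; case: eqP => // e.
  by case/negP: h; apply/imfsetP; exists k.
rewrite Delta_M.
under eq_bigr do rewrite raddf_sum /= scaler_suml.
rewrite exchange_big /=; apply: eq_bigr => k _.
rewrite (big_fsetD1 (st_take k A, st_drop k A)) /=; last first.
  by apply/imfsetP; exists k.
rewrite mcoeffUU scale1r big1_seq ?addr0 // => AB /=; rewrite !inE => /andP [neq _].
by rewrite mcoeffU eq_sym (negbTE neq) scale0r.
Qed.

Definition is_antipode (S : {linear NCQSym R -> NCQSym R}) : Prop :=
  forall p, convolution S idfun p = counit p *: (1 : NCQSym R) /\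
            convolution idfun S p = counit p *: (1 : NCQSym R).

End NCQSymHopf.

Notation sc s := (@setcomp_of s%N isT).

(* Main.v *)
(* For a set composition with two blocks, S * id = 0 in degree > 0 together with
   S(M_B) = - M_B for a single block B gives
   - S(M_(A1,A2)) = M_(A1,A2) - M_st(A1) M_st(A2).  The products of two one-block
   basis elements are computed on words: the coefficient of w in M_A M_B
   depends only on the prefix of w whose length is the degree of A and on the
   remaining suffix, and the basis element M_C containing w is found by
   replacing each letter of w by its rank among the letters of w. *)

From mathcomp Require Import all_boot all_order all_algebra.
From mathcomp Require Import finmap zify.
From mathcomp.multinomials Require Import monalg.
Require Import Defs.

Set Implicit Arguments.
Unset Strict Implicit.
Unset Printing Implicit Defensive.

Import GRing.Theory.
Local Open Scope ring_scope.

(** * Packed words and coefficients of products *)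

Lemma index_ltn_sorted (s : seq nat) x : sorted ltn s -> x \in s ->
  index x s = count (gtn x) s.
Proof.
elim: s => //= y s IH ys; rewrite inE (eq_sym x); case: eqVneq => [<- _|_ /= xs].
  apply/esym/eqP; rewrite ltnn add0n eqn0Ngt -has_count -all_predC.
  apply: sub_all (order_path_min ltn_trans ys) => z /= yz.
  by rewrite -leqNgt ltnW.
by rewrite (IH (path_sorted ys) xs) (allP (order_path_min ltn_trans ys)).
Qed.

(** The packing of a word, with ranks counted from 0. Being free of sorting and finite sets, it
    evaluates on a word of variables once their comparisons are decided. *)
Definition packed (w : seq nat) : seq nat :=
  [seq count (gtn x) (undup w) | x <- w].

(** [w] is the monomial of [sc_of_word w] at its own sorted letters, so each canonical letter is an
    index in that list, that is, the number of distinct smaller letters. *)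
Lemma canon_sc_of_word w : canon (sc_of_word w) = packed w.
Proof.
set I := sort leq (undup w).
have sI : size I = size (sc_of_word w) by rewrite size_comp.
have uI : uniq I by rewrite sort_uniq undup_uniq.
have -> : packed w = [seq index x I | x <- w].
  apply/eq_in_map => x xw; rewrite index_ltn_sorted ?ltn_sorted_letters //.
    by apply/permP; rewrite perm_sym perm_sort.
  by rewrite mem_sort mem_undup.
rewrite -[in RHS](xword_comp w) xwordE // -map_comp -[LHS]map_id.
by apply/eq_in_map => k /canon_lt kA; rewrite /= index_uniq ?sI.
Qed.

Lemma canon_setcomp_of s (h : sc_wf s) :
  canon (setcomp_of h) =
  [seq find (fun b : seq nat => k \in b) s | k <- iota 1 (size (flatten s))].
Proof.
apply/eq_in_map => k kA; rewrite nth_iota; last exact: sc_find_lt.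
rewrite add0n /sc_blocks /= find_map; apply: eq_find => b /=.
by rewrite in_fset.
Qed.

Lemma sc_of_word_eq A w : (sc_of_word w == A) = (packed w == canon A).
Proof.
rewrite -canon_sc_of_word; apply/eqP/eqP => [-> //|e].
by rewrite -[LHS]comp_canon e comp_canon.
Qed.

(** Every monomial of [M R A] has length [sc_deg A], so only the cut at that position can
    contribute. *)
Lemma to_series_mulM (R : comPzRingType) A B w :
  to_series (M R A * M R B) w =
  ((sc_of_word (take (sc_deg A) w) == A) &&
   (sc_of_word (drop (sc_deg A) w) == B))%:R.
Proof.
rewrite to_seriesM /ps_mul.
under eq_bigr do rewrite !to_series_M !MseriesE -natrM mulnb.
case: (leqP (sc_deg A) (size w)) => [Aw|wA]; last first.
  (* Here [take] returns all of [w], whose degree is too small. *)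
  rewrite take_oversize ?(ltnW wA) // big1 => [|k _].
    by case: eqP => // e; move: wA; rewrite -e ltnn.
  by case: eqP => // e; move: wA; rewrite -e ltnNge /sc_deg /= size_take_min geq_minr.
rewrite (bigD1 (Ordinal (Aw : (sc_deg A < (size w).+1)%N))) //= big1 ?addr0 //.
move=> k /eqP neq; case: eqP => // e; case: neq; apply: val_inj => /=.
by rewrite -e /sc_deg /= size_takel // -ltnS.
Qed.

(** * Standardization of initial and final segments *)

Lemma cardfs_NN n : #|` NN n|%fset = n.
Proof. by rewrite /NN card_fseq undup_id ?iota_uniq ?size_iota. Qed.

(** The blocks cover 1, ..., n, and each k in this set has rank k there. *)
Lemma st_id (A : setcomp) : st A = A.
Proof.
rewrite /st -[RHS]map_id; apply/eq_in_map => B BA; rewrite sc_cover.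
have rE k : k \in B -> rank (NN (sc_deg A)) k = k.
  move=> kB; have : k \in fcover A by exact: (fsubsetP (in_cover_block BA)).
  rewrite sc_cover in_NN => /andP [k0 kA]; rewrite /rank.
  have -> : [fset j in NN (sc_deg A) | (j <= k)%N]%fset = NN k.
    by apply/fsetP => j; rewrite !inE /= !mem_iota; lia.
  exact: cardfs_NN.
apply/fsetP => k; apply/imfsetP/idP => [[j /= jB ->]|kB]; first by rewrite rE.
by exists k; rewrite ?rE.
Qed.

Lemma fcover1 B : fcover [:: B] = B.
Proof. by apply/fsetP => k; rewrite in_cover /= orbF. Qed.

(** A single block must be all of 1, ..., n. Standardized blocks can thus be identified by
    cardinality, without computing ranks. *)
Lemma setcomp_size1_inj (A B : setcomp) : size A = 1%N -> size B = 1%N ->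
  sc_deg A = sc_deg B -> A = B.
Proof.
move=> A1 B1 dAB; apply: setcomp_eq => //.
have blE (C : setcomp) : size C = 1%N -> (C : seq _) = [:: NN (sc_deg C)].
  move=> sC; have := sc_cover C.
  by case: (sc_blocks C) sC => [|D [|]] //= _; rewrite fcover1 => ->.
by rewrite (blE A) // (blE B) // dAB.
Qed.

Lemma setcomp_size0 (A : setcomp) : size A = 0%N -> A = sc_empty.
Proof.
move/size0nil => A0; apply: setcomp_eq; last exact: A0.
by rewrite -(cardfs_NN (sc_deg A)) -sc_cover A0 (sc_cover sc_empty) cardfs_NN.
Qed.

Lemma sc_degE (A : setcomp) : sc_deg A = #|` fcover A|%fset.
Proof. by rewrite sc_cover cardfs_NN. Qed.

Lemma st_sc_id (A : setcomp) bl (h : ordered_partition bl) :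
  bl = A -> st_sc h = A.
Proof.
move=> e; subst bl; apply: setcomp_eq; last exact: st_id.
by rewrite [RHS]sc_degE.
Qed.

Lemma st_take_oversize k (A : setcomp) : (size A <= k)%N -> st_take k A = A.
Proof. by move=> Ak; apply/st_sc_id/take_oversize. Qed.

Lemma st_drop0 (A : setcomp) : st_drop 0 A = A.
Proof. exact/st_sc_id/drop0. Qed.

Lemma size_st_take k (A : setcomp) : size (st_take k A) = size (take k A).
Proof. by rewrite size_map. Qed.

Lemma size_st_drop k (A : setcomp) : size (st_drop k A) = (size A - k)%N.
Proof. by rewrite size_map size_drop. Qed.

Lemma st_take0 (A : setcomp) : st_take 0 A = sc_empty.
Proof. by apply: setcomp_size0; rewrite size_st_take take0. Qed.

Lemma st_drop_oversize k (A : setcomp) : (size A <= k)%N -> st_drop k A = sc_empty.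
Proof. by move=> Ak; apply: setcomp_size0; rewrite size_st_drop; apply/eqP. Qed.

(** * The antipode on at most two blocks *)

Lemma antipode_conv (R : comPzRingType) (S : {linear NCQSym R -> NCQSym R})
    (A : setcomp) : is_antipode S ->
  \sum_(k < (size A).+1) S (M R (st_take k A)) * M R (st_drop k A) =
  (A == sc_empty)%:R.
Proof.
move=> /(_ (M R A)) [+ _].
rewrite (convolution_M S idfun) => ->.
by rewrite /counit mcoeffU; case: eqP => _; rewrite ?scale1r ?scale0r.
Qed.

Lemma antipode1 (R : comPzRingType) (S : {linear NCQSym R -> NCQSym R}) :
  is_antipode S -> S (M R sc_empty) = 1.
Proof.
move=> /(antipode_conv sc_empty); rewrite eqxx big_ord1 st_take0 st_drop0.
by rewrite -[M R sc_empty in X in _ * X]/(1 : NCQSym R) mulr1.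
Qed.

(** The cuts k = 0 and k = 1 contribute M_A and S(M_A), and their sum vanishes. *)
Lemma antipode_size1 (R : comPzRingType) (S : {linear NCQSym R -> NCQSym R})
    (A : setcomp) : is_antipode S -> size A = 1%N -> S (M R A) = - M R A.
Proof.
move=> hS A1; have := antipode_conv A hS.
rewrite A1 big_ord_recl big_ord1 /= st_take0 st_drop0 (antipode1 hS) mul1r.
rewrite st_take_oversize ?A1 // st_drop_oversize ?A1 //.
rewrite -[M R sc_empty]/(1 : NCQSym R) mulr1.
case: eqP => [e|_ /eqP]; first by rewrite e in A1.
by rewrite addrC addr_eq0 => /eqP.
Qed.

Lemma antipode_size2 (R : comPzRingType) (S : {linear NCQSym R -> NCQSym R})
    (A : setcomp) : is_antipode S -> size A = 2%N ->
  - S (M R A) = M R A - M R (st_take 1 A) * M R (st_drop 1 A).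
Proof.
move=> hS A2; have := antipode_conv A hS.
rewrite A2 !big_ord_recl big_ord0 /= st_take0 st_drop0 (antipode1 hS) mul1r.
rewrite [st_take _.+2 _]st_take_oversize ?A2 // [st_drop _.+2 _]st_drop_oversize ?A2 //.
rewrite -[M R sc_empty]/(1 : NCQSym R) mulr1.
(* In the middle term k = 1 the left factor has one block, so S negates it. *)
rewrite (antipode_size1 hS); last by rewrite size_st_take size_takel ?A2.
case: eqP => [e|_ /eqP]; first by rewrite e in A2.
by rewrite addr0 addrA addr_eq0 mulNr => /eqP.
Qed.

(** * The two products and the four values *)

(** The product is the sum of all x_i x_i x_j; the cases i = j, j < i and i < j give the three
    summands in this order. *)
Lemma mulM_12_1 (R : comPzRingType) :
  M R (sc [:: [:: 1; 2]]) * M R (sc [:: [:: 1]]) =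
  M R (sc [:: [:: 1; 2; 3]]) + M R (sc [:: [:: 3]; [:: 1; 2]])
  + M R (sc [:: [:: 1; 2]; [:: 3]]).
Proof.
apply: to_series_inj => w.
rewrite to_series_mulM !to_seriesD !to_series_M !MseriesE !sc_of_word_eq.
(* All coefficients are images of naturals, so the comparison takes place in [nat]. *)
rewrite !canon_setcomp_of -!natrD -!eqseqE; congr _%:R.
(* Only words of length 3 can have a nonzero coefficient; the relative order of their letters
   determines the packing. *)
case: w => [|x [|y [|z [|t w]]]] //=; rewrite ?andbF // !inE.
by case: (ltngtP x y) => xy; case: (ltngtP y z) => yz;
  case: (ltngtP x z) => xz /=; lia.
Qed.

(** Here the sum runs over all x_i x_j x_j, split by i = j, j < i and i < j. *)
Lemma mulM_1_12 (R : comPzRingType) :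
  M R (sc [:: [:: 1]]) * M R (sc [:: [:: 1; 2]]) =
  M R (sc [:: [:: 1; 2; 3]]) + M R (sc [:: [:: 2; 3]; [:: 1]])
  + M R (sc [:: [:: 1]; [:: 2; 3]]).
Proof.
apply: to_series_inj => w.
rewrite to_series_mulM !to_seriesD !to_series_M !MseriesE !sc_of_word_eq.
rewrite !canon_setcomp_of -!natrD -!eqseqE; congr _%:R.
case: w => [|x [|y [|z [|t w]]]] //=; rewrite ?andbF // !inE.
by case: (ltngtP x y) => xy; case: (ltngtP y z) => yz;
  case: (ltngtP x z) => xz /=; lia.
Qed.

Lemma antipode_two_blocks (R : comPzRingType) (S : {linear NCQSym R -> NCQSym R})
    (b c b' c' : seq nat) (h : sc_wf [:: b; c]) (hb : sc_wf [:: b'])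
    (hc : sc_wf [:: c']) : is_antipode S ->
  size b = size b' -> size c = size c' ->
  - S (M R (setcomp_of h)) =
  M R (setcomp_of h) - M R (setcomp_of hb) * M R (setcomp_of hc).
Proof.
move=> hS bb' cc'; rewrite (@antipode_size2 _ _ (setcomp_of h) hS erefl).
(* Without repetitions, the cardinality of each block is the length of its list. *)
have /andP [_ pe] := h; have : uniq (flatten [:: b; c]).
  by rewrite (perm_uniq pe) iota_uniq.
rewrite /= cats0 cat_uniq => /and3P [ub _ uc].
have -> : st_take 1 (setcomp_of h) = setcomp_of hb.
  apply: setcomp_size1_inj; [by [] | by [] |].
  by rewrite {1}/sc_deg /= fcover1 card_fseq undup_id // /sc_deg /= cats0.
have -> // : st_drop 1 (setcomp_of h) = setcomp_of hc.
apply: setcomp_size1_inj; [by [] | by [] |].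
by rewrite {1}/sc_deg /= fcover1 card_fseq undup_id // /sc_deg /= cats0.
Qed.

Theorem corollary5p40 (R : comPzRingType)
    (S : {linear NCQSym R -> NCQSym R}) (hS : is_antipode S) :
  [/\ - S (M R (sc [:: [:: 1; 3]; [:: 2]]))
        = M R (sc [:: [:: 1; 3]; [:: 2]]) - M R (sc [:: [:: 1; 2; 3]])
          - M R (sc [:: [:: 3]; [:: 1; 2]]) - M R (sc [:: [:: 1; 2]; [:: 3]]),
      - S (M R (sc [:: [:: 2]; [:: 1; 3]]))
        = M R (sc [:: [:: 2]; [:: 1; 3]]) - M R (sc [:: [:: 1; 2; 3]])
          - M R (sc [:: [:: 2; 3]; [:: 1]]) - M R (sc [:: [:: 1]; [:: 2; 3]]),
      - S (M R (sc [:: [:: 2; 3]; [:: 1]]))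
        = M R (sc [:: [:: 2; 3]; [:: 1]]) - M R (sc [:: [:: 1; 2; 3]])
          - M R (sc [:: [:: 1; 2]; [:: 3]]) - M R (sc [:: [:: 3]; [:: 1; 2]])
    & - S (M R (sc [:: [:: 3]; [:: 1; 2]]))
        = M R (sc [:: [:: 3]; [:: 1; 2]]) - M R (sc [:: [:: 1; 2; 3]])
          - M R (sc [:: [:: 1]; [:: 2; 3]]) - M R (sc [:: [:: 2; 3]; [:: 1]])].
Proof.
split.
- have -> := @antipode_two_blocks R S [:: 1; 3]%N [:: 2]%N [:: 1; 2]%N [:: 1]%N isT isT isT hS erefl erefl.
  by rewrite mulM_12_1 !opprD !addrA.
- have -> := @antipode_two_blocks R S [:: 2]%N [:: 1; 3]%N [:: 1]%N [:: 1; 2]%N isT isT isT hS erefl erefl.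
  by rewrite mulM_1_12 !opprD !addrA.
(* The block sizes are those of (13,2), hence the same product; its last two terms are wanted in the
   other order. *)
- have -> := @antipode_two_blocks R S [:: 2; 3]%N [:: 1]%N [:: 1; 2]%N [:: 1]%N isT isT isT hS erefl erefl.
  by rewrite mulM_12_1 !opprD !addrA; exact: addrAC.
- have -> := @antipode_two_blocks R S [:: 3]%N [:: 1; 2]%N [:: 1]%N [:: 1; 2]%N isT isT isT hS erefl erefl.
  by rewrite mulM_1_12 !opprD !addrA; exact: addrAC.
Qed.
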